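(* Let $n$ be an almost-prime number, let $p$ be a prime divisor of $n$, and let $s=s_1s_2\cdots s_r$ be a divisor of $p-1$, where $s_i=q_i^{\nu_i}$ with $q_1,\dots,q_r$ distinct odd primes and $\nu_i\ge1$. Let $g_1,\dots,g_r$ be fixed generators of the groups $(\mathbb{Z}/s_i\mathbb{Z})^{*}$ respectively. For a tuple $L=(l_1,\dots,l_r)$ of integers let $\omega_L$ be the number of distinct prime divisors $p'$ of $n$ with $p'\equiv g_j^{l_j}\pmod{s_j}$ for all $1\le j\le r$. Let $\zeta$ be a primitive $\varphi(s)$-th root of unity, $K=\mathbb{Q}(\zeta)$, and $\mathcal{O}_K=\mathbb{Z}[\zeta]$ its ring of integers. Define $$f(x_1,\dots,x_r)=\prod_{L=(l_1,\dots,l_r)}\left(1+\prod_{i=1}^r x_i^{l_i}\right)^{\omega_L},$$ the product running over all tuples $L$ with $1\le l_i\le\varphi(s_i)$ for each $i$. Then for any $\eta_1,\dots,\eta_r$ such that $\eta_i$ is a $\varphi(s_i)$-th root of unity for each $i$, we have $f(\eta_1,\dots,\eta_r)\equiv d(n)\pmod p$ in $\mathcal{O}_K$, i.e. $f(\eta_1,\dots,\eta_r)-d(n)\in p\mathcal{O}_K$.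
   Context: For a positive integer $n$ with positive divisors $1=d_1<d_2<\dots<d_k=n$, define the polynomial $T_n(x)=x^{d_1}+x^{d_2}+\dots+x^{d_k}-kx$. A positive integer $n$ is called weakly almost-prime if $n\mid T_n(x)$ for all integers $x$; it is called almost-prime if it is weakly almost-prime and square-free. $d(n)$ denotes the number of positive divisors of $n$, and $\varphi$ is Euler's totient function. *)

(* Defs.v *)
From HB Require Import structures.
From mathcomp Require Import all_boot all_order all_fingroup all_algebra.
From mathcomp Require Import all_solvable all_field.

Set Implicit Arguments.
Unset Strict Implicit.
Unset Printing Implicit Defensive.

Import Order.TTheory GRing.Theory Num.Theory.
Local Open Scope ring_scope.

Definition num_divisors (n : nat) : nat := size (divisors n).

Definition T_poly (n : nat) : {poly int} :=
  \sum_(d <- divisors n) 'X^d - (num_divisors n)%:R *: 'X.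

Definition weakly_almost_prime (n : nat) : Prop :=
  (0 < n)%N /\ forall x : int, (n%:Z %| (T_poly n).[x])%Z.

Definition squarefree (n : nat) : Prop :=
  forall d : nat, (d ^ 2 %| n)%N -> d = 1%N.

Definition almost_prime (n : nat) : Prop :=
  weakly_almost_prime n /\ squarefree n.

(* The congruence p' = g_j ^ l_j mod s_j is an equality in 'Z_(s j), which is
   Z/(s_j) as soon as 1 < s j; the exponent l_j may be negative since g_j is a
   unit. *)
Definition omega (n r : nat) (s : 'I_r -> nat)
    (g : forall j : 'I_r, {unit 'Z_(s j)}) (L : 'I_r -> int) : nat :=
  size [seq p' <- primes n |
         [forall j : 'I_r, (p'%:R : 'Z_(s j)) == FinRing.uval (g j) ^ L j]].

(* The tuple L with entries in 'I_(totient (s i)) stands for l_i = (L i).+1,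
   so that l_i ranges over 1, ..., totient (s i). *)
Definition f_prod (n r : nat) (s : 'I_r -> nat)
    (g : forall j : 'I_r, {unit 'Z_(s j)})
    (R : comNzRingType) (x : 'I_r -> R) : R :=
  \prod_(L : {dffun forall i : 'I_r, 'I_(totient (s i))})
    (1 + \prod_(i < r) x i ^+ (L i).+1)
      ^+ omega n g (fun i => ((L i).+1)%:Z).

(* Q(zeta), as the set of quotients of rational polynomial expressions in
   zeta; a zero denominator contributes only 0, by the convention z / 0 = 0. *)
Definition rat_adjoin (zeta z : algC) : Prop :=
  exists P Q : {poly rat}, z = (map_poly ratr P).[zeta] / (map_poly ratr Q).[zeta].

Definition ring_of_integers (zeta z : algC) : Prop :=
  rat_adjoin zeta z /\ z \in Aint.

Definition int_adjoin (zeta z : algC) : Prop :=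
  exists P : {poly int}, z = (map_poly intr P).[zeta].

Definition congr_mod (A : algC -> Prop) (m : nat) (a b : algC) : Prop :=
  exists2 z : algC, A z & a - b = m%:R * z.

(* Main.v *)
(* The values eta_i define a Dirichlet character chi modulo s by sending each
   g_i to eta_i.  As n is squarefree, expanding the product gives
   f(eta) = \prod_(p' | n) (1 + chi p') = \sum_(d | n) chi d.  Since p | n, the
   polynomial T_n vanishes on F_p; reducing its exponents modulo p - 1 leaves a
   polynomial of degree < p - 1 vanishing on F_p^*, hence zero.  So the number of
   divisors of n in a residue class c modulo p - 1 is 0 modulo p, except for
   c = 1, where it is d(n).  As chi is periodic modulo p - 1, grouping the sum by
   residue class gives f(eta) = chi 1 * d(n) = d(n) modulo p Z[zeta]. *)
Require Import Defs.
From HB Require Import structures.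
From mathcomp Require Import all_boot all_order all_fingroup all_algebra.
From mathcomp Require Import all_solvable all_field.

Set Implicit Arguments.
Unset Strict Implicit.
Unset Printing Implicit Defensive.

Import Order.TTheory GRing.Theory Num.Theory.
Local Open Scope ring_scope.

(** * Divisor sums over squarefree numbers *)

Lemma divisors_prime_mul (p m : nat) :
  prime p -> (0 < m)%N -> ~~ (p %| m)%N ->
  perm_eq (divisors (p * m)) (divisors m ++ map (muln p) (divisors m)).
Proof.
move=> pp m0 npm; have p0 := prime_gt0 pp.
apply: uniq_perm; first exact: divisors_uniq.
  rewrite cat_uniq divisors_uniq map_inj_uniq ?divisors_uniq ?andbT /=; last first.
    by move=> a b /eqP; rewrite eqn_pmul2l // => /eqP.
  apply/hasPn => _ /mapP [e _ ->]; rewrite -dvdn_divisors //.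
  by apply: contra npm; apply: dvdn_trans; apply: dvdn_mulr.
move=> d; rewrite mem_cat -!dvdn_divisors ?muln_gt0 ?p0 //.
apply/idP/orP => [dpm | [dm | /mapP [e]]]; last 2 first.
- by rewrite dvdn_mull.
- by rewrite -dvdn_divisors // => em ->; rewrite dvdn_pmul2l.
have [/dvdnP [e de] | npd] := boolP (p %| d)%N.
  right; apply/mapP; exists e; last by rewrite de mulnC.
  by move: dpm; rewrite de mulnC dvdn_pmul2l // -dvdn_divisors.
by left; move: dpm; rewrite Gauss_dvdr // coprime_sym prime_coprime.
Qed.

(** Induction on [ps]: a new prime [p] adds to each divisor [d] the divisor [p * d], so by
    multiplicativity the sum gains the factor [1 + F p]. *)
Lemma sum_divisors_prod_primes (R : comNzRingType) (F : nat -> R) (ps : seq nat) :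
  F 1%N = 1 -> {morph F : a b / (a * b)%N >-> a * b} ->
  uniq ps -> all prime ps ->
  \sum_(d <- divisors (\prod_(p <- ps) p)) F d = \prod_(p <- ps) (1 + F p).
Proof.
move=> F1 FM; elim: ps => [|p ps IH] /=; first by rewrite !big_nil big_seq1.
case/andP=> p_ps ups /andP [pp aps]; rewrite !big_cons.
have m0 : (0 < \prod_(q <- ps) q)%N.
  by rewrite big_seq prodn_cond_gt0 // => q /(allP aps) /prime_gt0.
have npm : ~~ (p %| \prod_(q <- ps) q)%N.
  rewrite Euclid_dvd_prod // big_has; apply/hasPn => q qps /=.
  rewrite dvdn_prime2 //; last exact: (allP aps).
  by apply: contraNneq p_ps => ->.
rewrite (perm_big _ (divisors_prime_mul pp m0 npm)) big_cat big_map /=.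
rewrite [X in _ + X](eq_bigr (fun d => F p * F d)) => [|d _]; last exact: FM.
by rewrite -mulr_sumr IH // mulrDl mul1r.
Qed.

Lemma prod_primes_squarefree (n : nat) :
  (0 < n)%N -> squarefree n -> (\prod_(p <- primes n) p)%N = n.
Proof.
move=> n0 sqf; rewrite {2}(prod_prime_decomp n0) prime_decompE big_map /=.
apply: eq_big_seq => p p_n; have := p_n; rewrite -logn_gt0 => lp.
suff -> : logn p n = 1%N by rewrite expn1.
apply/eqP; rewrite eqn_leq lp andbT leqNgt; apply/negP => l2.
have /sqf p1 : (p ^ 2 %| n)%N by rewrite pfactor_dvdn //; move: p_n; rewrite mem_primes => /andP [].
by move: lp; rewrite p1 lognE.
Qed.

(** * Characters given by a generator *)

(* The character of Z/m sending the generator g to e, and non-units to 0. *)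
Definition unit_char (R : nzRingType) (m : nat) (g : {unit 'Z_m}) (e : R)
    (a : nat) : R :=
  if [pick k : 'I_#[g]%g | (a%:R : 'Z_m) == FinRing.uval (g ^+ k)%g] is Some k
  then e ^+ k else 0.

Section UnitChar.
Variables (R : comNzRingType) (m : nat) (g : {unit 'Z_m}) (e : R).
Hypotheses (gen_g : generator (units_Zp m) g) (e1 : e ^+ #[g]%g = 1).

(** The exponent of [g] is determined only modulo [#[g]]; by [e1] the power of [e] does not depend
    on the choice. *)
Lemma unit_charX (a k : nat) :
  (a%:R : 'Z_m) = FinRing.uval (g ^+ k)%g -> unit_char g e a = e ^+ k.
Proof.
move=> ak; rewrite /unit_char; case: pickP => [l | /(_ (Ordinal (ltn_pmod k (order_gt0 g))))].
  rewrite ak => /eqP /val_inj /eqP; rewrite eq_expg_mod_order => /eqP kl.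
  by rewrite -(expr_mod l e1) -kl expr_mod.
by rewrite /= ak expg_mod_order eqxx.
Qed.

Lemma unit_char_non_unit (a : nat) :
  (a%:R : 'Z_m) \isn't a GRing.unit -> unit_char g e a = 0.
Proof.
move=> nu; rewrite /unit_char; case: pickP => // k /eqP ak.
by move: nu; rewrite ak (valP (g ^+ k)%g).
Qed.

Lemma unit_gen_expg (a : nat) :
  (a%:R : 'Z_m) \is a GRing.unit ->
  exists k, (a%:R : 'Z_m) = FinRing.uval (g ^+ k)%g.
Proof.
move=> ua; have : FinRing.unit 'Z_m ua \in <[g]>%g by rewrite -(eqP gen_g) inE.
by case/cycleP => k gk; exists k; rewrite -gk.
Qed.

Lemma unit_char1 : unit_char g e 1 = 1.
Proof. by rewrite (@unit_charX 1 0). Qed.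

Lemma unit_charM : {morph unit_char g e : a b / (a * b)%N >-> a * b}.
Proof.
move=> a b; have [ua | nua] := boolP ((a%:R : 'Z_m) \is a GRing.unit); last first.
  by rewrite !(@unit_char_non_unit _ nua) unit_char_non_unit ?mul0r // natrM unitrM (negPf nua).
have [ub | nub] := boolP ((b%:R : 'Z_m) \is a GRing.unit); last first.
  by rewrite (unit_char_non_unit nub) unit_char_non_unit ?mulr0 // natrM unitrM (negPf nub) andbF.
have [k ak] := unit_gen_expg ua; have [l bl] := unit_gen_expg ub.
rewrite (unit_charX ak) (unit_charX bl) -exprD; apply: unit_charX.
by rewrite natrM ak bl expgD.
Qed.

Lemma unit_char_mod (N a : nat) : (1 < m)%N -> (m %| N)%N ->
  unit_char g e (a %% N) = unit_char g e a.
Proof.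
move=> m1 mN; suff E : ((a %% N)%:R : 'Z_m) = a%:R by rewrite /unit_char E.
by rewrite -(Zp_nat_mod m1 (a %% N)) modn_dvdm // Zp_nat_mod.
Qed.

End UnitChar.

(** * Divisors of n in residue classes modulo p - 1 *)

(** The two sides differ by the coefficient at [c] of T_n with exponents reduced modulo p - 1. The
    class of 1 is written [1 %% p.-1] because it is 0 when p = 2. *)
Lemma divisor_residues (n p c : nat) :
  weakly_almost_prime n -> prime p -> (p %| n)%N -> (c < p.-1)%N ->
  (\sum_(d <- divisors n | (d %% p.-1)%N == c) 1)%:R =
    ((c == 1 %% p.-1)%N * num_divisors n)%:R :> 'F_p.
Proof.
move=> [n0 wap] pp pn cp.
have p1 : (0 < p.-1)%N by rewrite -subn1 subn_gt0 prime_gt1.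
pose P : {poly 'F_p} := \sum_(d <- divisors n) 'X^(d %% p.-1)
                          - (num_divisors n)%:R *: 'X^(1 %% p.-1).
have exp_mod (x : 'F_p) d : x != 0 -> x ^+ (d %% p.-1) = x ^+ d.
  (* Cancelling [x] in x^p = x gives x^(p-1) = 1. *)
  move=> x0; apply: expr_mod; apply: (mulfI x0).
  by rewrite -exprS prednK ?prime_gt0 // mulr1 -[in X in _ ^+ X](card_Fp pp) expf_card.
suff /polyP /(_ c) : P = 0.
  rewrite coef0 coefB coef_sum coefZ coefXn => /eqP.
  rewrite subr_eq0 => /eqP E; rewrite mulnC natrM -E natr_sum big_mkcond.
  by apply: eq_bigr => d _; rewrite coefXn eq_sym; case: eqP.
apply/eqP; apply: contraT => nzP.
(* A nonzero [P] has fewer than [size P] roots, hence fewer than p - 1; but all p - 1 nonzero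
   elements of F_p are roots. *)
have := @max_poly_roots _ P [seq x <- enum 'F_p | x != 0] nzP.
rewrite filter_uniq ?enum_uniq //.
have -> : size [seq x <- enum 'F_p | x != 0] = p.-1.
  have := cardC1 (0 : 'F_p); rewrite card_Fp // => <-.
  rewrite cardE /enum_mem !size_filter count_filter.
  by apply: eq_count => x; rewrite !inE andbT.
have szP : (size P <= p.-1)%N.
  rewrite /P (leq_trans (size_polyD _ _)) // geq_max size_polyN.
  rewrite (leq_trans (size_scale_leq _ _)) ?size_polyXn ?ltn_pmod // andbT.
  rewrite (leq_trans (size_sum _ _ _)) //; apply/bigmax_leqP_seq => d _ _.
  by rewrite size_polyXn ltn_pmod.
rewrite ltnNge szP => no_roots; apply: no_roots => //.
apply/allP => x; rewrite mem_filter => /andP [x0 _].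
rewrite /root /P hornerD hornerN hornerZ horner_sum.
under eq_bigr do rewrite hornerXn exp_mod //.
rewrite hornerXn exp_mod // expr1.
(* Divisibility by n holds over the integers: apply it to the representative of [x], then reduce
   modulo p, where n becomes 0. *)
have /dvdzP [y] := wap (x : nat)%:Z.
rewrite /T_poly hornerD hornerN hornerZ horner_sum hornerX.
rewrite (eq_bigr (fun d => (x : nat)%:Z ^+ d)) => [|d _]; last exact: hornerXn.
move=> /(congr1 (intr : int -> 'F_p)).
have nF : n%:R = 0 :> 'F_p by apply/eqP; rewrite -(dvdn_pcharf (pchar_Fp pp)).
rewrite rmorphB rmorph_sum /= !rmorphM /= rmorph_nat.
have xE : (x : nat)%:Z%:~R = x :> 'F_p by rewrite -pmulrn natr_Zp.
rewrite xE -[n%:~R]pmulrn nF mulr0 => /eqP; rewrite subr_eq0 => /eqP <-.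
by rewrite subr_eq0; apply/eqP; apply: eq_bigr => d _; rewrite rmorphXn /= xE.
Qed.

(** * The ring Z[zeta] and congruences in it *)

Section IntAdjoin.
Variable zeta : algC.

Lemma int_adjoin_int (m : int) : int_adjoin zeta m%:~R.
Proof. by exists m%:P; rewrite map_polyC hornerC. Qed.

Lemma int_adjoinX (k : nat) : int_adjoin zeta (zeta ^+ k).
Proof. by exists 'X^k; rewrite map_polyXn hornerXn. Qed.

Lemma int_adjoinD (x y : algC) :
  int_adjoin zeta x -> int_adjoin zeta y -> int_adjoin zeta (x + y).
Proof. by case=> P -> [Q ->]; exists (P + Q); rewrite rmorphD hornerD. Qed.

Lemma int_adjoinM (x y : algC) :
  int_adjoin zeta x -> int_adjoin zeta y -> int_adjoin zeta (x * y).
Proof. by case=> P -> [Q ->]; exists (P * Q); rewrite rmorphM hornerM. Qed.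

Lemma int_adjoin_sum (I : Type) (r : seq I) (F : I -> algC) :
  (forall i, int_adjoin zeta (F i)) -> int_adjoin zeta (\sum_(i <- r) F i).
Proof.
by move=> h; apply: big_ind => //; [apply: (int_adjoin_int 0) | apply: int_adjoinD].
Qed.

Lemma int_adjoin_prod (I : Type) (r : seq I) (F : I -> algC) :
  (forall i, int_adjoin zeta (F i)) -> int_adjoin zeta (\prod_(i <- r) F i).
Proof.
by move=> h; apply: big_ind => //; [apply: (int_adjoin_int 1) | apply: int_adjoinM].
Qed.

(** This inclusion of Z[zeta] in O_K carries the congruence over to O_K. *)
Lemma int_adjoin_integers (x : algC) :
  zeta \in Aint -> int_adjoin zeta x -> ring_of_integers zeta x.
Proof.
move=> zA [P ->]; split.
  exists (map_poly intr P), 1; rewrite rmorph1 hornerC divr1 -map_poly_comp.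
  by congr (_.[_]); apply: eq_map_poly => a /=; rewrite ratr_int.
apply: rpred_horner => //; apply/polyOverP => i; rewrite coef_map /=.
exact: Aint_int.
Qed.

End IntAdjoin.

Lemma sum_divisors_congr (n p : nat) (zeta : algC) (F : nat -> algC) :
  weakly_almost_prime n -> prime p -> (p %| n)%N ->
  (forall d, F (d %% p.-1)%N = F d) -> (forall d, int_adjoin zeta (F d)) ->
  congr_mod (int_adjoin zeta) p (\sum_(d <- divisors n) F d)
    (F 1%N * (num_divisors n)%:R).
Proof.
move=> wap pp pn Fmod Fint.
have p1 : (0 < p.-1)%N by rewrite -subn1 subn_gt0 prime_gt1.
pose N (c : nat) : nat := (\sum_(d <- divisors n | (d %% p.-1)%N == c) 1)%N.
pose D (c : nat) : nat := ((c == 1 %% p.-1) * num_divisors n)%N.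
(* The equality in F_p becomes a divisibility in Z. The integer quotients [z c], weighted by [F c],
   then form the witness of the congruence. *)
have /fin_all_exists [z zP] (c : 'I_p.-1) :
    exists z : int, (N c)%:R - (D c)%:R = p%:R * z%:~R :> algC.
  have : (p%:Z %| (N c)%:Z - (D c)%:Z)%Z.
    rewrite -eqz_mod_dvd !modz_nat eqz_nat.
    have := divisor_residues wap pp pn (ltn_ord c).
    move=> /(congr1 (fun x : 'F_p => x : nat)).
    by rewrite !val_Fp_nat // => ->.
  case/dvdzP => z zE; exists z.
  by rewrite !pmulrn -rmorphB zE mulrC rmorphM.
exists (\sum_(c < p.-1) F c * (z c)%:~R).
  by apply: int_adjoin_sum => c; apply: int_adjoinM; last apply: int_adjoin_int.
have -> : \sum_(d <- divisors n) F d = \sum_(c < p.-1) F c * (N c)%:R.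
  rewrite (eq_bigr (fun d => \sum_(c < p.-1 | (d %% p.-1)%N == c) F c)) => [|d _].
    rewrite (exchange_big_dep predT) //=; apply: eq_bigr => c _.
    by rewrite natr_sum mulr_sumr; apply: eq_bigr => d _; rewrite mulr1.
  by rewrite (big_pred1 (Ordinal (ltn_pmod d p1))) //= => c; rewrite eq_sym.
have -> : F 1%N * (num_divisors n)%:R = \sum_(c < p.-1) F c * (D c)%:R.
  rewrite (bigD1 (Ordinal (ltn_pmod 1 p1))) //= big1 => [|c].
    by rewrite addr0 Fmod /D eqxx mul1n.
  by rewrite -val_eqE /= /D => /negPf ->; rewrite mulr0.
rewrite -sumrB mulr_sumr; apply: eq_bigr => c _.
by rewrite -mulrBr zP mulrCA.
Qed.

(** * From tuples of exponents to primes *)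

(** Used to see each [eta i] as a power of [zeta]. *)
Lemma totient_dvd_prod_coprime (r : nat) (s : 'I_r -> nat) (i : 'I_r) :
  (forall j, j != i -> coprime (s i) (s j)) ->
  (totient (s i) %| totient (\prod_(j < r) s j))%N.
Proof.
move=> co; rewrite (bigD1 i) //= totient_coprime ?dvdn_mulr //.
apply: (big_ind (coprime (s i))) => [|a b ca cb|j]; last exact: co.
  exact: coprimen1.
by rewrite coprimeMr ca.
Qed.

(** The exponent [omega] counts primes, so the products over tuples and primes can be exchanged. A
    prime that is a unit modulo every [s i] matches exactly one tuple; any other prime matches none,
    and its factor is 1 since some character value is 0. *)
Lemma f_prod_primes (n r : nat) (s : 'I_r -> nat)
    (g : forall j : 'I_r, {unit 'Z_(s j)}) (R : comNzRingType) (x : 'I_r -> R) :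
  (forall i, generator (units_Zp (s i)) (g i)) ->
  (forall i, (0 < s i)%N) ->
  (forall i, x i ^+ totient (s i) = 1) ->
  f_prod n g x = \prod_(p <- primes n) (1 + \prod_(i < r) unit_char (g i) (x i) p).
Proof.
move=> gen_g s_gt0 x1.
have og i : #[g i]%g = totient (s i).
  by rewrite -card_units_Zp // (eqP (gen_g i)).
have t_gt0 i : (0 < totient (s i))%N by rewrite totient_gt0.
pose match_res (p : nat) (L : {dffun forall i : 'I_r, 'I_(totient (s i))}) :=
  [forall j, (p%:R : 'Z_(s j)) == FinRing.uval (g j) ^ ((L j).+1)%:Z].
have -> : f_prod n g x =
    \prod_L \prod_(p <- primes n | match_res p L) (1 + \prod_(i < r) x i ^+ (L i).+1).
  by apply: eq_bigr => L _; rewrite /omega size_filter big_const_seq iter_mulr_1.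
rewrite (exchange_big_dep predT) //=; apply: eq_bigr => p _.
have [all_unit | ] := boolP [forall i, (p%:R : 'Z_(s i)) \is a GRing.unit]; last first.
  rewrite negb_forall => /existsP [i nu].
  rewrite (bigD1 i) //= unit_char_non_unit // mul0r addr0 big_pred0 // => L.
  apply: contraNF nu => /forallP /(_ i) /eqP ->; exact: unitrX (valP (g i)).
have /fin_all_exists [k kP] i : exists k : 'I_(totient (s i)),
    (p%:R : 'Z_(s i)) = FinRing.uval (g i ^+ k.+1)%g.
  have [k ->] := unit_gen_expg (gen_g i) (forallP all_unit i).
  (* The index stands for its successor, so [k] must be lowered by 1 modulo the totient; adding the
     totient minus 1 avoids truncated subtraction. *)
  exists (Ordinal (ltn_pmod (k + (totient (s i)).-1) (t_gt0 i))) => /=.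
  congr FinRing.uval; apply/eqP; rewrite eq_expg_mod_order og -addn1 modnDml.
  by rewrite -addnA addn1 prednK // modnDr.
rewrite (big_pred1 (finfun k : {dffun forall i : 'I_r, 'I_(totient (s i))})) => [|L]; last first.
  apply/forallP/eqP => [LP | -> j]; last by rewrite ffunE kP FinRing.val_unitX.
  apply/ffunP => j; rewrite ffunE; apply/val_inj.
  have := LP j; rewrite kP -exprnP -FinRing.val_unitX => /eqP /val_inj /eqP.
  rewrite eq_expg_mod_order og -[(k j).+1]addn1 -[(L j).+1]addn1.
  by rewrite eqn_modDr !modn_small // => /eqP.
congr (1 + _); apply: eq_bigr => i _.
by rewrite ffunE (unit_charX _ (kP i)) ?og.
Qed.

(* The last conjunction is congruence modulo p in O_K for both descriptions
   of O_K: the algebraic integers of K = Q(zeta), and Z[zeta]. *)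
Theorem theorem1p12 (n p r : nat) (q nu s : 'I_r -> nat)
    (g : forall i : 'I_r, {unit 'Z_(s i)}) (zeta : algC) (eta : 'I_r -> algC) :
  almost_prime n ->
  prime p -> (p %| n)%N ->
  (forall i, prime (q i) /\ odd (q i)) ->
  injective q ->
  (forall i, (0 < nu i)%N) ->
  (forall i, s i = (q i ^ nu i)%N) ->
  (\prod_(i < r) s i %| p - 1)%N ->
  (forall i, generator (units_Zp (s i)) (g i)) ->
  (totient (\prod_(i < r) s i)).-primitive_root zeta ->
  (forall i, (totient (s i)).-unity_root (eta i)) ->
  congr_mod (ring_of_integers zeta) p (f_prod n g eta) (num_divisors n)%:R /\
  congr_mod (int_adjoin zeta) p (f_prod n g eta) (num_divisors n)%:R.
Proof.
move=> [wap sqf] pp pn q_prime q_inj nu_gt0 sE s_p gen_g prim_zeta eta1.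
have s_gt1 i : (1 < s i)%N.
  by rewrite sE -(exp1n (nu i)) ltn_exp2r // prime_gt1 //; case: (q_prime i).
have etaE i : eta i ^+ totient (s i) = 1 by apply/eqP; rewrite -unity_rootE.
have og i : #[g i]%g = totient (s i).
  by rewrite -card_units_Zp ?(ltnW (s_gt1 i)) // (eqP (gen_g i)).
have eta_og i : eta i ^+ #[g i]%g = 1 by rewrite og.
have s_coprime i j : j != i -> coprime (s i) (s j).
  move=> ji; have [qi _] := q_prime i; have [qj _] := q_prime j.
  rewrite !sE coprimeXl // coprimeXr // prime_coprime // dvdn_prime2 //.
  by rewrite (inj_eq q_inj) eq_sym.
have eta_int i k : int_adjoin zeta (eta i ^+ k).
  (* Since phi(s_i) divides phi(s), [eta i] is a phi(s)-th root of unity, hence a power of the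
     primitive root [zeta]. *)
  have /dvdnP [c cE] := totient_dvd_prod_coprime (s_coprime i).
  have [|l ->] := prim_rootP prim_zeta (x := eta i).
    by rewrite cE mulnC exprM etaE expr1n.
  by rewrite -exprM; apply: int_adjoinX.
pose chi (a : nat) := \prod_(i < r) unit_char (g i) (eta i) a.
have chi_int a : int_adjoin zeta (chi a).
  apply: int_adjoin_prod => i; rewrite /unit_char; case: pickP => // _.
  exact: (int_adjoin_int _ 0).
have chi1 : chi 1%N = 1 by apply: big1 => i _; apply: unit_char1.
have chiM : {morph chi : a b / (a * b)%N >-> a * b}.
  by move=> a b; rewrite -big_split; apply: eq_bigr => i _; apply: unit_charM.
have chi_mod a : chi (a %% p.-1)%N = chi a.
  apply: eq_bigr => i _; apply: unit_char_mod => //.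
  (* Each [s i] divides s, which divides p - 1, so p - 1 is a period of every factor. *)
  by rewrite -subn1; apply: dvdn_trans s_p; rewrite (bigD1 i) //= dvdn_mulr.
have congr_zeta : congr_mod (int_adjoin zeta) p (f_prod n g eta) (num_divisors n)%:R.
  rewrite f_prod_primes // => [|i]; last exact: ltnW.
  rewrite -(sum_divisors_prod_primes chi1 chiM) ?primes_uniq ?all_prime_primes //.
  rewrite prod_primes_squarefree //; last by case: wap.
  by have := sum_divisors_congr wap pp pn chi_mod chi_int; rewrite chi1 mul1r.
split=> //; case: congr_zeta => z zint zE; exists z => //.
by apply: int_adjoin_integers => //; apply: Aint_prim_root prim_zeta.
Qed.
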